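(* Let $\mathcal{K}$ be a category with countable products, let $F:\mathcal{K}\to\mathcal{K}$ be an endofunctor that has a right adjoint $R$, and let $O$ be an object of $\mathcal{K}$. Let $(O_\infty,d_\infty,s_\infty)$ be the terminal object of the category $F\text{-}\mathsf{Mre}$ of $F$-Moore machines of output $O$, with carrier $O_\infty=\prod_{n\ge 0}R^nO$. There exists a functor $$B: F\text{-}\mathsf{Mre}\to \mathsf{Alg}(F)_{/(O_\infty,d_\infty)},$$ where the codomain is the slice category of $F$-algebras over the $F$-algebra $(O_\infty,d_\infty)$, defined as follows: on objects, $B$ sends $(E,d,s)$ to the $F$-algebra $(E,d)$ together with the $F$-algebra homomorphism $u_E:E\to O_\infty$ underlying the unique morphism of $F$-Moore machines $(E,d,s)\to(O_\infty,d_\infty,s_\infty)$; on morphisms, $B$ acts as the identity, $f\mapsto f$. The functor $B$ has a left adjoint $L$.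
   Context: An $F$-Moore machine of output $O$ is a triple $(E,d,s)$ with $E$ an object of $\mathcal{K}$ (its carrier) and $d:FE\to E$, $s:E\to O$ morphisms of $\mathcal{K}$. A morphism $(E,d,s)\to(T,d',s')$ of $F$-Moore machines is a morphism $f:E\to T$ of $\mathcal{K}$ with $f\circ d=d'\circ Ff$ and $s'\circ f=s$; composition and identities are those of $\mathcal{K}$. $\mathsf{Alg}(F)$ is the category of algebras for the endofunctor $F$: objects are pairs $(A,a)$ with $a:FA\to A$, and morphisms $(A,a)\to(B,b)$ are morphisms $f:A\to B$ with $f\circ a=b\circ Ff$. An object of $\mathsf{Alg}(F)_{/(O_\infty,d_\infty)}$ is thus a pair $((A,a),u)$ with $(A,a)$ an $F$-algebra and $u:A\to O_\infty$ a morphism with $d_\infty\circ Fu=u\circ a$. $R^n$ denotes the $n$-fold composite of $R$ (with $R^0$ the identity functor). Under the stated hypotheses the category of $F$-Moore machines of output $O$ has a terminal object $(O_\infty,d_\infty,s_\infty)$ with carrier $\prod_{n\ge 0}R^nO$. *)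

(* Defs.v *)
From mathcomp Require Import all_boot.
From mathcomp Require Import boolp.

Set Implicit Arguments.
Unset Strict Implicit.
Unset Printing Implicit Defensive.

Declare Scope category_scope.
Delimit Scope category_scope with cat.
Local Open Scope category_scope.

Record category : Type := Category {
  ob :> Type;
  Hom : ob -> ob -> Type;
  idm : forall X : ob, Hom X X;
  compm : forall X Y Z : ob, Hom Y Z -> Hom X Y -> Hom X Z;
  comp1m : forall (X Y : ob) (f : Hom X Y), compm (idm Y) f = f;
  compm1 : forall (X Y : ob) (f : Hom X Y), compm f (idm X) = f;
  compmA : forall (X Y Z T : ob) (h : Hom Z T) (g : Hom Y Z) (f : Hom X Y),
    compm h (compm g f) = compm (compm h g) f
}.

Arguments Hom {c} X Y.
Arguments idm {c} X.
Arguments compm {c X Y Z} g f.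

Notation "g ∘ f" := (compm g f) (at level 40, left associativity)
  : category_scope.

(* [functor_on F0] is a functor whose action on objects is the given map [F0].
   Keeping [F0] as a parameter makes it possible to prescribe the object map of
   a functor without transporting morphisms along equalities of objects. *)
Record functor_on (C D : category) (F0 : C -> D) : Type := FunctorOn {
  fhom : forall X Y : C, Hom X Y -> Hom (F0 X) (F0 Y);
  fhom_id : forall X : C, fhom (idm X) = idm (F0 X);
  fhom_comp : forall (X Y Z : C) (g : Hom Y Z) (f : Hom X Y),
    fhom (g ∘ f) = fhom g ∘ fhom f
}.

Record functor (C D : category) : Type := Functor {
  fobj :> C -> D;
  functor_str : functor_on fobj
}.

Definition fmap (C D : category) (F : functor C D) (X Y : C) (f : Hom X Y) :
  Hom (F X) (F Y) := fhom (functor_str F) f.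

Arguments fmap {C D} F {X Y} f.

Lemma fmap_id (C D : category) (F : functor C D) (X : C) :
  fmap F (idm X) = idm (F X).
Proof. exact: fhom_id. Qed.

Lemma fmap_comp (C D : category) (F : functor C D) (X Y Z : C)
    (g : Hom Y Z) (f : Hom X Y) :
  fmap F (g ∘ f) = fmap F g ∘ fmap F f.
Proof. exact: fhom_comp. Qed.

Definition id_functor (C : category) : functor C C :=
  @Functor C C (fun X => X)
    (@FunctorOn C C (fun X => X) (fun _ _ f => f)
       (fun _ => erefl) (fun _ _ _ _ _ => erefl)).

Section CompFunctor.
Variables (C D E : category) (G : functor D E) (F : functor C D).

Lemma comp_fmap_id (X : C) : fmap G (fmap F (idm X)) = idm (G (F X)).
Proof. by rewrite !fmap_id. Qed.

Lemma comp_fmap_comp (X Y Z : C) (g : Hom Y Z) (f : Hom X Y) :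
  fmap G (fmap F (g ∘ f)) = fmap G (fmap F g) ∘ fmap G (fmap F f).
Proof. by rewrite !fmap_comp. Qed.

Definition comp_functor : functor C E :=
  @Functor C E (fun X => G (F X))
    (@FunctorOn C E (fun X => G (F X)) (fun _ _ f => fmap G (fmap F f))
       comp_fmap_id comp_fmap_comp).
End CompFunctor.

Fixpoint iter_functor (C : category) (R : functor C C) (n : nat) :
    functor C C :=
  if n is m.+1 then comp_functor R (iter_functor R m) else id_functor C.

Record adjunction (C D : category) (L : functor C D) (R : functor D C) : Type :=
  Adjunction {
  transp : forall (X : C) (Y : D), Hom (L X) Y -> Hom X (R Y);
  untransp : forall (X : C) (Y : D), Hom X (R Y) -> Hom (L X) Y;
  transpK : forall (X : C) (Y : D), cancel (@transp X Y) (@untransp X Y);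
  untranspK : forall (X : C) (Y : D), cancel (@untransp X Y) (@transp X Y);
  transp_natl : forall (X X' : C) (Y : D) (g : Hom (L X) Y) (f : Hom X' X),
    transp (g ∘ fmap L f) = transp g ∘ f;
  transp_natr : forall (X : C) (Y Y' : D) (h : Hom Y Y') (g : Hom (L X) Y),
    transp (h ∘ g) = fmap R h ∘ transp g
}.

Definition has_left_adjoint (C D : category) (R : functor D C) : Prop :=
  exists L : functor C D, inhabited (adjunction L R).

Record is_terminal (C : category) (T : C) : Type := IsTerminal {
  bang : forall X : C, Hom X T;
  bang_uniq : forall (X : C) (f : Hom X T), f = bang X
}.

Record product (C : category) (I : Type) (X : I -> C) : Type := Product {
  prod_ob : C;
  proj : forall i : I, Hom prod_ob (X i);
  tuplem : forall Y : C, (forall i : I, Hom Y (X i)) -> Hom Y prod_ob;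
  proj_tuplem : forall (Y : C) (f : forall i : I, Hom Y (X i)) (i : I),
    proj i ∘ tuplem f = f i;
  tuplem_uniq : forall (Y : C) (f : forall i : I, Hom Y (X i))
    (g : Hom Y prod_ob), (forall i : I, proj i ∘ g = f i) -> g = tuplem f
}.

(* Chosen products of all families indexed by countable, possibly finite or
   empty, sets. *)
Definition countable_products (C : category) : Type :=
  forall (I : countType) (X : I -> C), product X.

Section Slice.
Variables (C : category) (S : C).

Record slice_ob : Type := SliceOb {
  slice_dom : C;
  slice_map : Hom slice_dom S
}.

Record slice_hom (X Y : slice_ob) : Type := SliceHom {
  slice_mor : Hom (slice_dom X) (slice_dom Y);
  slice_homP : slice_map Y ∘ slice_mor = slice_map X
}.

Lemma slice_hom_ext (X Y : slice_ob) (f g : slice_hom X Y) :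
  slice_mor f = slice_mor g -> f = g.
Proof.
by case: f g => [f pf] [g pg] /= e; case: _ / e pg => pg; congr SliceHom.
Qed.

Lemma slice_idP (X : slice_ob) :
  slice_map X ∘ idm (slice_dom X) = slice_map X.
Proof. exact: compm1. Qed.

Lemma slice_compP (X Y Z : slice_ob) (g : slice_hom Y Z) (f : slice_hom X Y) :
  slice_map Z ∘ (slice_mor g ∘ slice_mor f) = slice_map X.
Proof. by rewrite compmA !slice_homP. Qed.

Definition slice : category.
Proof.
refine (@Category slice_ob slice_hom (fun X => SliceHom (slice_idP X))
  (fun _ _ _ g f => SliceHom (slice_compP g f)) _ _ _) => *;
  apply: slice_hom_ext; [exact: comp1m | exact: compm1 | exact: compmA].
Defined.
End Slice.

Section Algebras.
Variables (K : category) (F : functor K K).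

Record algebra : Type := Algebra {
  alg_carrier : K;
  alg_act : Hom (F alg_carrier) alg_carrier
}.

Record alg_hom (A B : algebra) : Type := AlgHom {
  alg_mor : Hom (alg_carrier A) (alg_carrier B);
  alg_homP : alg_mor ∘ alg_act A = alg_act B ∘ fmap F alg_mor
}.

Lemma alg_hom_ext (A B : algebra) (f g : alg_hom A B) :
  alg_mor f = alg_mor g -> f = g.
Proof.
by case: f g => [f pf] [g pg] /= e; case: _ / e pg => pg; congr AlgHom.
Qed.

Lemma alg_idP (A : algebra) :
  idm (alg_carrier A) ∘ alg_act A = alg_act A ∘ fmap F (idm (alg_carrier A)).
Proof. by rewrite fmap_id comp1m compm1. Qed.

Lemma alg_compP (A B D : algebra) (g : alg_hom B D) (f : alg_hom A B) :
  (alg_mor g ∘ alg_mor f) ∘ alg_act A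
  = alg_act D ∘ fmap F (alg_mor g ∘ alg_mor f).
Proof. by rewrite -compmA alg_homP compmA alg_homP fmap_comp compmA. Qed.

Definition Alg : category.
Proof.
refine (@Category algebra alg_hom (fun A => AlgHom (alg_idP A))
  (fun _ _ _ g f => AlgHom (alg_compP g f)) _ _ _) => *;
  apply: alg_hom_ext; [exact: comp1m | exact: compm1 | exact: compmA].
Defined.
End Algebras.

Section MooreMachines.
Variables (K : category) (F : functor K K) (O : K).

Record moore : Type := Moore {
  mre_carrier : K;
  mre_d : Hom (F mre_carrier) mre_carrier;
  mre_s : Hom mre_carrier O
}.

Record moore_hom (E T : moore) : Type := MooreHom {
  mre_mor : Hom (mre_carrier E) (mre_carrier T);
  mre_homd : mre_mor ∘ mre_d E = mre_d T ∘ fmap F mre_mor;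
  mre_homs : mre_s T ∘ mre_mor = mre_s E
}.

Lemma moore_hom_ext (E T : moore) (f g : moore_hom E T) :
  mre_mor f = mre_mor g -> f = g.
Proof.
case: f g => [f df sf] [g dg sg] /= e.
by case: _ / e dg sg => dg sg; congr MooreHom.
Qed.

Lemma moore_idd (E : moore) :
  idm (mre_carrier E) ∘ mre_d E = mre_d E ∘ fmap F (idm (mre_carrier E)).
Proof. by rewrite fmap_id comp1m compm1. Qed.

Lemma moore_ids (E : moore) : mre_s E ∘ idm (mre_carrier E) = mre_s E.
Proof. exact: compm1. Qed.

Lemma moore_compd (E T U : moore) (g : moore_hom T U) (f : moore_hom E T) :
  (mre_mor g ∘ mre_mor f) ∘ mre_d E
  = mre_d U ∘ fmap F (mre_mor g ∘ mre_mor f).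
Proof. by rewrite -compmA mre_homd compmA mre_homd fmap_comp compmA. Qed.

Lemma moore_comps (E T U : moore) (g : moore_hom T U) (f : moore_hom E T) :
  mre_s U ∘ (mre_mor g ∘ mre_mor f) = mre_s E.
Proof. by rewrite compmA !mre_homs. Qed.

Definition Mre : category.
Proof.
refine (@Category moore moore_hom (fun E => MooreHom (moore_idd E) (moore_ids E))
  (fun _ _ _ g f => MooreHom (moore_compd g f) (moore_comps g f)) _ _ _) => *;
  apply: moore_hom_ext; [exact: comp1m | exact: compm1 | exact: compmA].
Defined.

Definition mre_alg (E : moore) : algebra F := Algebra (mre_d E).

Definition mre_alg_hom (E T : moore) (f : moore_hom E T) :
  alg_hom (mre_alg E) (mre_alg T) :=
  @AlgHom K F (mre_alg E) (mre_alg T) (mre_mor f) (mre_homd f).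

(* [bang hT E] is the unique morphism of machines from [E] to the terminal
   machine [T]; its underlying algebra morphism is u_E. *)
Definition B_ob (T : Mre) (hT : is_terminal T) (E : Mre) :
    slice (mre_alg T : Alg F) :=
  @SliceOb (Alg F) (mre_alg T) (mre_alg E) (mre_alg_hom (bang hT E)).
End MooreMachines.

Section Oinfty.
Variables (K : category) (prods : countable_products K).
Variables (R : functor K K) (O : K).

Definition Oinfty_product : product (fun n : nat => iter_functor R n O) :=
  prods (fun n : nat => iter_functor R n O).

Definition Oinfty : K := prod_ob Oinfty_product.
End Oinfty.

(* A terminal Moore machine with carrier [Oinfty prods R O] does exist, so that
   assuming one is no restriction: s is the 0-th projection, and the n-th
   component of d corresponds to the projection onto R^(n+1) O under F -| R. *)
Section TerminalMachine.
Variables (K : category) (prods : countable_products K).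
Variables (F R : functor K K) (adj : adjunction F R) (O : K).

Let P : product (fun n : nat => iter_functor R n O) := Oinfty_product prods R O.

Let untr (n : nat) (X : K) :
    Hom X (iter_functor R n.+1 O) -> Hom (F X) (iter_functor R n O) :=
  @untransp K K F R adj X (iter_functor R n O).

Let tr (n : nat) (X : K) :
    Hom (F X) (iter_functor R n O) -> Hom X (iter_functor R n.+1 O) :=
  @transp K K F R adj X (iter_functor R n O).

Definition dinfty : Hom (F (Oinfty prods R O)) (Oinfty prods R O) :=
  tuplem P (fun n : nat => untr (proj P n.+1)).

Definition sinfty : Hom (Oinfty prods R O) O := proj P 0.

Let out (E : moore F O) :=
  fix out (n : nat) : Hom (mre_carrier E) (iter_functor R n O) :=
    match n with
    | 0 => mre_s E
    | m.+1 => tr (out m ∘ mre_d E)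
    end.

Let untr_nat (n : nat) (X X' : K) (g : Hom X (iter_functor R n.+1 O))
    (f : Hom X' X) : untr (g ∘ f) = untr g ∘ fmap F f.
Proof.
apply: (can_inj (@transpK _ _ _ _ adj _ _)).
by rewrite transp_natl !(untranspK adj).
Qed.

Lemma moore_terminal :
  inhabited (is_terminal (Moore dinfty sinfty : Mre F O)).
Proof.
have u_d (E : moore F O) : tuplem P (out E) ∘ mre_d E
    = dinfty ∘ fmap F (tuplem P (out E)).
  transitivity (tuplem P (fun n => out E n ∘ mre_d E)).
    by apply: tuplem_uniq => n; rewrite compmA proj_tuplem.
  apply/esym/tuplem_uniq => n.
  rewrite compmA (proj_tuplem P) -untr_nat (proj_tuplem P) /=.
  exact: transpK.
have u_s (E : moore F O) : sinfty ∘ tuplem P (out E) = mre_s E.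
  exact: (proj_tuplem P (out E) 0).
constructor.
apply: (@IsTerminal (Mre F O) (Moore dinfty sinfty)
  (fun E => @MooreHom K F O E (Moore dinfty sinfty) _ (u_d E) (u_s E))).
move=> E [f fd fs]; apply: moore_hom_ext => /=.
rewrite /= in f fd fs *.
apply: (tuplem_uniq (p := P)); elim=> [|n IHn]; first exact: fs.
rewrite [RHS]/= -IHn -compmA fd compmA (proj_tuplem P) -untr_nat.
exact: (esym (untranspK adj _)).
Qed.
End TerminalMachine.

(* Main.v *)
(* The left adjoint sends ((A, a), u) to the machine (A, a, s_inf ∘ u). Since u
   is then a machine morphism to the terminal machine, terminality makes the
   output condition s_E ∘ f = s_inf ∘ u on an algebra morphism f : A -> E
   equivalent to the slice condition u_E ∘ f = u; both transpositions are
   therefore the identity on underlying morphisms. *)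
From mathcomp Require Import ssreflect ssrfun ssrbool.
Require Import Defs.

Set Implicit Arguments.
Unset Strict Implicit.
Unset Printing Implicit Defensive.

Local Open Scope category_scope.

Section MooreSlice.
Variables (K : category) (F : functor K K) (O : K).
Variables (T : moore F O) (hT : @is_terminal (Mre F O) T).

Local Notation AlgT := (@slice (Alg F) (mre_alg T)).

Lemma terminal_eq (E : moore F O) (f g : moore_hom E T) : f = g.
Proof.
exact: etrans (@bang_uniq (Mre F O) T hT E f)
  (esym (@bang_uniq (Mre F O) T hT E g)).
Qed.

(** Both sides underlie machine morphisms from [X] to the terminal [T]. *)
Lemma B_homP (X Y : moore F O) (f : moore_hom X Y) :
  @compm (Alg F) _ _ _ (slice_map (B_ob hT Y)) (mre_alg_hom f)
  = slice_map (B_ob hT X).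
Proof.
apply: alg_hom_ext.
exact: (congr1 (@mre_mor K F O _ T)
  (terminal_eq (@compm (Mre F O) _ _ _ (bang hT Y) f) (bang hT X))).
Qed.

Definition B_hom (X Y : moore F O) (f : moore_hom X Y) :
    @Hom AlgT (B_ob hT X) (B_ob hT Y) :=
  @SliceHom (Alg F) _ (B_ob hT X) (B_ob hT Y) (mre_alg_hom f) (B_homP f).

Definition B_functor_on : @functor_on (Mre F O) AlgT (B_ob hT).
Proof.
by refine (@FunctorOn (Mre F O) AlgT (B_ob hT) B_hom _ _) => *;
  apply: slice_hom_ext; apply: alg_hom_ext.
Defined.

Definition L_ob (A : AlgT) : moore F O :=
  Moore (alg_act (slice_dom A)) (mre_s T ∘ alg_mor (slice_map A)).

Lemma L_homs (A A' : AlgT) (f : Hom A A') :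
  mre_s (L_ob A') ∘ alg_mor (slice_mor f) = mre_s (L_ob A).
Proof. by rewrite /= -compmA -(slice_homP f). Qed.

Definition L_hom (A A' : AlgT) (f : Hom A A') : moore_hom (L_ob A) (L_ob A') :=
  @MooreHom _ _ _ (L_ob A) (L_ob A') _ (alg_homP (slice_mor f)) (L_homs f).

Definition L_functor : functor AlgT (Mre F O).
Proof.
by refine (@Functor AlgT (Mre F O) L_ob
  (@FunctorOn AlgT (Mre F O) L_ob L_hom _ _)) => *; apply: moore_hom_ext.
Defined.

(** Outputs are preserved by the very choice of output in [L_ob], so the structure map of [A] is the
    unique machine morphism to [T]. *)
Definition structure_hom (A : AlgT) : moore_hom (L_ob A) T :=
  @MooreHom _ _ _ (L_ob A) T _ (alg_homP (slice_map A)) erefl.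

(* [mre_alg_hom] does not fit here: [mre_alg (L_ob A)] equals [slice_dom A] only
   up to eta for records. *)
Definition LB_alg_hom (A : AlgT) (E : moore F O) (f : moore_hom (L_ob A) E) :
    alg_hom (slice_dom A) (mre_alg E) :=
  @AlgHom K F (slice_dom A) (mre_alg E) (mre_mor f) (mre_homd f).

(** Terminality at [L_ob A] identifies [f] followed by [bang hT E] with [structure_hom A]. *)
Lemma LB_transpP (A : AlgT) (E : moore F O) (f : moore_hom (L_ob A) E) :
  @compm (Alg F) _ _ _ (slice_map (B_ob hT E)) (LB_alg_hom f)
  = slice_map A.
Proof.
apply: alg_hom_ext.
exact: (congr1 (@mre_mor K F O _ T)
  (terminal_eq (@compm (Mre F O) _ _ _ (bang hT E) f) (structure_hom A))).
Qed.

Definition LB_transp (A : AlgT) (E : moore F O) (f : moore_hom (L_ob A) E) :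
    @Hom AlgT A (B_ob hT E) :=
  @SliceHom (Alg F) _ A (B_ob hT E) (LB_alg_hom f) (LB_transpP f).

(** Since u_E preserves outputs, [mre_s E] factors as [mre_s T] after u_E, and the slice condition
    turns u_E ∘ f into the structure map of [A]. *)
Lemma LB_untransps (A : AlgT) (E : moore F O)
    (f : @Hom AlgT A (B_ob hT E)) :
  mre_s E ∘ alg_mor (slice_mor f) = mre_s (L_ob A).
Proof.
by rewrite /= -(slice_homP f) /= compmA (mre_homs (bang hT E)).
Qed.

Definition LB_untransp (A : AlgT) (E : moore F O)
    (f : @Hom AlgT A (B_ob hT E)) : moore_hom (L_ob A) E :=
  @MooreHom _ _ _ (L_ob A) E _ (alg_homP (slice_mor f)) (LB_untransps f).

Definition LB_adjunction : adjunction L_functor (Functor B_functor_on).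
Proof.
refine (@Adjunction AlgT (Mre F O) L_functor (Functor B_functor_on)
  LB_transp LB_untransp _ _ _ _).
- by move=> A E f; apply: moore_hom_ext.
- by move=> A E f; apply: slice_hom_ext; apply: alg_hom_ext.
- by move=> A A' E g f; apply: slice_hom_ext; apply: alg_hom_ext.
- by move=> A E E' h g; apply: slice_hom_ext; apply: alg_hom_ext.
Defined.

End MooreSlice.

Theorem theorem3p8
  (K : category) (prods : countable_products K)
  (F R : functor K K) (adj : adjunction F R) (O : K)
  (d_inf : Hom (F (Oinfty prods R O)) (Oinfty prods R O))
  (s_inf : Hom (Oinfty prods R O) O)
  (term : @is_terminal (Mre F O) (Moore d_inf s_inf)) :
  exists B : @functor_on (Mre F O) (@slice (Alg F) (Algebra d_inf)) (B_ob term),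
    (forall (E T : Mre F O) (f : @Hom (Mre F O) E T),
       alg_mor (slice_mor (fhom B f)) = mre_mor f)
    /\ has_left_adjoint (Functor B).
Proof.
(* [B_functor_on] is transparent, so its action on morphisms is checked by conversion. *)
exists (B_functor_on term); split=> //.
by exists (L_functor (Moore d_inf s_inf)); constructor; exact: (LB_adjunction term).
Qed.
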